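(* For every positive integer $n$, let $\mathcal{L}_n$ be the lattice of partitions of $n$ under the dominance ordering and $\mathcal{J}(\mathcal{L}_n)$ its set of join-irreducible elements. Then $|\mathcal{J}(\mathcal{L}_1)|=0$, and for every $n\geq 1$, \[|\mathcal{J}(\mathcal{L}_{n+1})|=|\mathcal{J}(\mathcal{L}_n)|+\left\lfloor \frac{n}{3}\right\rfloor+1.\]
   Context: A partition of a positive integer $n$ is an $n$-tuple $(a_1,\ldots,a_n)$ of natural numbers with $a_1\geq a_2\geq\cdots\geq a_n\geq 0$ and $a_1+\cdots+a_n=n$ (trailing zeros may be omitted, and are implicitly added when comparing tuples of different lengths). The dominance ordering on partitions of $n$ is: $(a_i)\geq(b_i)$ iff $\sum_{i=1}^j a_i\geq\sum_{i=1}^j b_i$ for all $j\geq1$; with this order the partitions of $n$ form a lattice $\mathcal{L}_n$. An element of a lattice is join-irreducible if it is not the least element and whenever it equals $b\vee c$ it equals $b$ or $c$ (in a finite lattice: it covers exactly one element). *)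

(* Defs.v *)
From HB Require Import structures.
From mathcomp Require Import all_boot all_order.

Set Implicit Arguments.
Unset Strict Implicit.
Unset Printing Implicit Defensive.

Import Order.TTheory.

Definition is_intpart (n : nat) (a : n.-tuple nat) : bool :=
  sorted geq a && (sumn a == n).

Record intpart (n : nat) : Type := IntPart {
  parts :> n.-tuple nat;
  _ : is_intpart parts
}.

HB.instance Definition _ (n : nat) := [isSub for @parts n].
HB.instance Definition _ (n : nat) := [Countable of intpart n by <:].

Lemma intpart_leq (n : nat) (a : intpart n) (i : 'I_n) : tnth a i < n.+1.
Proof.
case: a => a /= /andP[_ /eqP sa]; rewrite ltnS -{2}sa sumnE big_tuple.
by rewrite (bigD1 i) //= leq_addr.
Qed.

Definition intpart_code (n : nat) (a : intpart n) : n.-tuple 'I_n.+1 :=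
  [tuple Ordinal (intpart_leq a i) | i < n].

Definition intpart_decode (n : nat) (t : n.-tuple 'I_n.+1) : option (intpart n) :=
  insub [tuple val (tnth t i) | i < n].

Lemma intpart_codeK (n : nat) : pcancel (@intpart_code n) (@intpart_decode n).
Proof.
move=> a; rewrite /intpart_decode.
have -> : [tuple val (tnth (intpart_code a) i) | i < n] = parts a.
  by apply: eq_from_tnth => i; rewrite !tnth_mktuple.
exact: valK.
Qed.

HB.instance Definition _ (n : nat) : isFinite (intpart n) :=
  PCanIsFinite (@intpart_codeK n).

(* Indices past the end of [s] count as parts equal to 0. *)
Definition psum (s : seq nat) (j : nat) : nat := \sum_(i < j) nth 0 s i.

(* Partial sums of a partition of n equal n from index n on, so testing j <= n
   suffices; see dominatedP. *)
Definition dominated (n : nat) (a b : intpart n) : bool :=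
  [forall j : 'I_n.+1, psum a j <= psum b j].

Lemma psumS (s : seq nat) (j : nat) : psum s j.+1 = psum s j + nth 0 s j.
Proof. exact: big_ord_recr. Qed.

Lemma psum_size (s : seq nat) (j : nat) : size s <= j -> psum s j = sumn s.
Proof.
move=> sj; rewrite sumnE (big_nth 0) big_mkord /psum.
rewrite [RHS](big_ord_widen j (fun i => nth 0 s i)) // [RHS]big_mkcond /=.
by apply: eq_bigr => i _; case: (ltnP i (size s)) => // /(nth_default 0) ->.
Qed.

Lemma psum_full (n : nat) (a : intpart n) (j : nat) : n <= j -> psum a j = n.
Proof.
move=> nj; rewrite psum_size ?size_tuple //.
by case: a => a /= /andP[_ /eqP].
Qed.

Lemma dominatedP (n : nat) (a b : intpart n) :
  reflect (forall j, psum a j <= psum b j) (dominated a b).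
Proof.
apply: (iffP forallP) => ab j; last exact: ab.
case: (ltnP j n.+1) => jn; first exact: (ab (Ordinal jn)).
by rewrite !psum_full // ltnW.
Qed.

Lemma dominated_refl (n : nat) : reflexive (@dominated n).
Proof. by move=> a; apply/dominatedP. Qed.

Lemma dominated_anti (n : nat) : antisymmetric (@dominated n).
Proof.
move=> a b /andP[/dominatedP ab /dominatedP ba].
have E j : psum a j = psum b j by apply/eqP; rewrite eqn_leq ab ba.
apply/val_inj/eq_from_tnth => i; rewrite !(tnth_nth 0).
by apply: (@addnI (psum a i)); rewrite -psumS !E psumS.
Qed.

Lemma dominated_trans (n : nat) : transitive (@dominated n).
Proof.
move=> b a c /dominatedP ab /dominatedP bc.
by apply/dominatedP => j; apply: leq_trans (ab j) (bc j).
Qed.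

Fact dominance_display : Order.disp_t. Proof. exact: Order.Disp tt tt. Qed.

HB.instance Definition _ (n : nat) :=
  Order.Le_isPOrder.Build dominance_display (intpart n)
    (@dominated_refl n) (@dominated_anti n) (@dominated_trans n).

Lemma intpart_leE (n : nat) (a b : intpart n) : (a <= b)%O = dominated a b.
Proof. by []. Qed.

Lemma intpart_noninc (n : nat) (a : intpart n) (j : nat) :
  nth 0 a j.+1 <= nth 0 a j.
Proof.
case: a => a /= /andP[sa _].
case: (ltnP j.+1 (size a)) => ja; last by rewrite (nth_default 0 ja).
by move/(sortedP 0): sa; apply.
Qed.

(* The meet has as partial sums the pointwise minimum of the partial sums. *)
Definition minsum (s t : seq nat) (j : nat) : nat := minn (psum s j) (psum t j).

Definition meet_tuple (n : nat) (a b : intpart n) : n.-tuple nat :=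
  [tuple minsum a b i.+1 - minsum a b i | i < n].

Lemma minsumS (s t : seq nat) (j : nat) : minsum s t j <= minsum s t j.+1.
Proof.
rewrite /minsum leq_min !psumS.
by rewrite (leq_trans (geq_minl _ _)) ?(leq_trans (geq_minr _ _)) ?leq_addr.
Qed.

Lemma minsum_concave (n : nat) (a b : intpart n) (j : nat) :
  minsum a b j.+2 - minsum a b j.+1 <= minsum a b j.+1 - minsum a b j.
Proof.
rewrite leq_subLR addnBA ?minsumS // leq_subRL; last first.
  by rewrite (leq_trans (minsumS _ _ _)) // leq_addr.
have /(_ j) na := intpart_noninc a; have /(_ j) nb := intpart_noninc b.
have ha : minsum a b j + minsum a b j.+2 <= (psum a j.+1) + (psum a j.+1).
  apply: (leq_trans (leq_add (geq_minl _ _) (geq_minl _ _))).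
  by rewrite !psumS -!addnA leq_add2l [leqRHS]addnCA !leq_add2l.
have hb : minsum a b j + minsum a b j.+2 <= (psum b j.+1) + (psum b j.+1).
  apply: (leq_trans (leq_add (geq_minr _ _) (geq_minr _ _))).
  by rewrite !psumS -!addnA leq_add2l [leqRHS]addnCA !leq_add2l.
by rewrite {3 4}/minsum; case: (leqP (psum a j.+1) (psum b j.+1)).
Qed.

Lemma psum_meet (n : nat) (a b : intpart n) (j : nat) :
  j <= n -> psum (meet_tuple a b) j = minsum a b j.
Proof.
elim: j => [|j IH] jn; first by rewrite /minsum /psum !big_ord0.
rewrite psumS (IH (ltnW jn)) -(tnth_nth 0 _ (Ordinal jn)) tnth_mktuple /=.
by rewrite subnKC // minsumS.
Qed.

Lemma meet_is_intpart (n : nat) (a b : intpart n) :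
  is_intpart (meet_tuple a b).
Proof.
apply/andP; split.
  apply/(sortedP 0) => i; rewrite size_tuple => iN.
  have iN' := ltnW iN.
  rewrite -(tnth_nth 0 _ (Ordinal iN)) -(tnth_nth 0 _ (Ordinal iN')).
  by rewrite !tnth_mktuple; apply: minsum_concave.
by rewrite -(@psum_size _ n) ?size_tuple // psum_meet // /minsum !psum_full ?minnn.
Qed.

Definition intpart_meet (n : nat) (a b : intpart n) : intpart n :=
  IntPart (meet_is_intpart a b).

Lemma intpart_meetP (n : nat) (a b c : intpart n) :
  (a <= intpart_meet b c)%O = (a <= b)%O && (a <= c)%O.
Proof.
rewrite !intpart_leE; apply/forallP/andP => [h|[/forallP ab /forallP ac] j].
  by split; apply/forallP => j; have := h j;
    rewrite psum_meet ?leq_ord // leq_min => /andP[].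
by rewrite psum_meet ?leq_ord // leq_min ab ac.
Qed.

HB.instance Definition _ (n : nat) :=
  Order.POrder_isMeetSemilattice.Build dominance_display (intpart n)
    (@intpart_meetP n).

Definition top_tuple (n : nat) : n.-tuple nat :=
  [tuple if i == 0 :> nat then n else 0 | i < n].

Lemma top_is_intpart (n : nat) : is_intpart (top_tuple n).
Proof.
apply/andP; split.
  apply/(sortedP 0) => i; rewrite size_tuple => iN.
  by rewrite -(tnth_nth 0 _ (Ordinal iN)) tnth_mktuple.
rewrite sumnE big_tuple; case: n => [|n]; first by rewrite big_ord0.
rewrite big_ord_recl tnth_mktuple /= big1 ?addn0 // => i _.
by rewrite tnth_mktuple.
Qed.

Lemma intpart_lex1 (n : nat) (a : intpart n) : (a <= IntPart (top_is_intpart n))%O.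
Proof.
rewrite intpart_leE; apply/forallP => -[[|j] jn]; first by rewrite /psum !big_ord0.
have -> : psum (IntPart (top_is_intpart n)) j.+1 = n.
  rewrite /psum big_ord_recl big1 => [|i _]; last first.
    have iN : lift ord0 i < n by apply: leq_trans (ltn_ord _) _.
    by rewrite -(tnth_nth 0 _ (Ordinal iN)) tnth_mktuple.
  have n0 : 0 < n by apply: leq_trans (ltn0Sn j) _.
  by rewrite addn0 -(tnth_nth 0 _ (Ordinal n0)) tnth_mktuple.
rewrite -[leqRHS](@psum_full n a n) //.
rewrite /psum (big_ord_widen n (fun i => nth 0 a i)) // big_mkcond.
by apply: leq_sum => i _; case: ifP.
Qed.

HB.instance Definition _ (n : nat) :=
  Order.hasTop.Build dominance_display (intpart n) (@intpart_lex1 n).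

Definition intpart_join (n : nat) (a b : intpart n) : intpart n :=
  (\meet_(c | (a <= c) && (b <= c)) c)%O.

Lemma intpart_joinP (n : nat) (a b c : intpart n) :
  (intpart_join a b <= c)%O = (a <= c)%O && (b <= c)%O.
Proof.
apply/idP/idP => [abc|abc]; last exact: meets_inf.
apply/andP; split; apply: le_trans abc.
  by apply/meetsP => d /andP[].
by apply/meetsP => d /andP[].
Qed.

HB.instance Definition _ (n : nat) :=
  Order.POrder_isJoinSemilattice.Build dominance_display (intpart n)
    (@intpart_joinP n).

Definition is_least {d : Order.disp_t} {T : finLatticeType d} (x : T) : bool :=
  [forall y : T, x <= y]%O.

Definition join_irreducible {d : Order.disp_t} {T : finLatticeType d} (x : T) : bool :=
  ~~ is_least x &&
  [forall b : T, forall c : T, (x == b `|` c)%O ==> ((x == b) || (x == c))].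

Definition JI {d : Order.disp_t} (T : finLatticeType d) : {set T} :=
  [set x | join_irreducible x].

(* Main.v *)
(* In a finite lattice, x is join-irreducible iff the set of elements strictly
   below x has a greatest element.  For a partition x with l parts >= 2, this
   happens exactly when l > 0, these parts differ by at most 1 and, if x also has
   a part 1 and its l-th part is 2, they are all equal to 2.
   Necessity: moving boxes from row a to row b lowers only partial sums at k with
   a < k <= b; two such moves with disjoint ranges have join x, and when the
   ranges share only l, concavity of partial sums rules out a partition whose
   partial sums differ from those of x at l alone.
   Sufficiency: under these conditions y >= x as soon as the k-th partial sum of
   y reaches that of x for one k in a suitable range, so the partial sums of every
   z < x are smaller on all of this range, and one box move lowers them by
   exactly 1 there.
   Such an x is determined by l and the sum m of its parts >= 2, so one counts the
   pairs (m, l) with l > 0 and either m = n >= 2l, or m < n and 3l <= m or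
   2l = m. *)
Require Import Defs.
From mathcomp Require Import all_boot all_order.
From mathcomp Require Import zify.

Set Implicit Arguments.
Unset Strict Implicit.
Unset Printing Implicit Defensive.

Import Order.TTheory.

(** * Join-irreducible elements of a finite lattice *)

Lemma join_irreducibleP {d : Order.disp_t} {T : finLatticeType d} (x : T) :
  reflect (exists2 y : T, (y < x)%O & forall z : T, (z < x)%O -> (z <= y)%O)
    (join_irreducible x).
Proof.
apply: (iffP andP) => [[nleast /forallP irr]|[y yx ymax]]; last first.
  split; first by apply/negP => /forallP /(_ y); rewrite (lt_geF yx).
  apply/forallP => b; apply/forallP => c; apply/implyP => /eqP xbc.
  apply/negPn; rewrite negb_or; apply/negP => /andP[xb xc].
  have: (x <= y)%O.
    by rewrite xbc leUx !ymax // lt_def ?xb ?xc xbc ?leUl ?leUr.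
  by rewrite (lt_geF yx).
have joinlt z z' : (z < x)%O -> (z' < x)%O -> (z `|` z' < x)%O.
  move=> zx z'x; rewrite lt_neqAle leUx !ltW // !andbT; apply/negP => /eqP xE.
  have := irr z => /forallP /(_ z'); rewrite -xE eqxx /=.
  by case/orP => /eqP E; move: zx z'x; rewrite -xE E ltxx.
have [z0 z0x] : exists z, (z < x)%O.
  move: nleast; rewrite negb_forall => /existsP[z xz]; exists (z `&` x)%O.
  rewrite lt_def leIr andbT; apply: contra xz => /eqP ->; exact: leIl.
(* The element y with the largest down-set works: if z were not below it, the join of y and z would
   be below x with a larger down-set. *)
case: (@arg_maxnP T z0 (fun z => z < x)%O (fun z => #|[set u | u <= z]%O|) z0x).
move=> y yx ymax; exists y => // z zx.
have /ymax := joinlt _ _ yx zx.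
rewrite /geq /= leqNgt; apply: contraR => yz; apply: proper_card; apply/properP; split.
  by apply/subsetP => u; rewrite !inE => /le_trans; apply; exact: leUl.
by exists z; rewrite !inE ?leUr.
Qed.

(** * Partial sums and comparison in dominance order *)

Section Partitions.
Variable n : nat.
Implicit Types x y z : intpart n.

Lemma intpart_mono x i j : i <= j -> nth 0 x j <= nth 0 x i.
Proof.
elim: j => [|j IH]; first by rewrite leqn0 => /eqP ->.
rewrite leq_eqVlt => /orP[/eqP -> //|/IH]; exact/leq_trans/intpart_noninc.
Qed.

Lemma intpart_nth0 x i : n <= i -> nth 0 x i = 0.
Proof. by move=> ni; rewrite nth_default // size_tuple. Qed.

Lemma leq_psum (s : seq nat) j k : j <= k -> psum s j <= psum s k.
Proof.
by move=> jk; apply: (homo_leq leqnn leq_trans) jk => i; rewrite psumS leq_addr.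
Qed.

Lemma psum_le x k : psum x k <= n.
Proof.
case: (leqP k n) => kn; last by rewrite psum_full // ltnW.
by rewrite -[leqRHS](@psum_full n x n) // leq_psum.
Qed.

Lemma psum_nth0 x k : nth 0 x k = 0 -> psum x k = n.
Proof.
move=> xk; case: (leqP n k) => kn; first exact: psum_full.
suff E d : psum x (k + d) = psum x k.
  by rewrite -(E (n - k)) psum_full ?subnKC // ltnW.
elim: d => [|d IH]; first by rewrite addn0.
rewrite addnS psumS -IH; have := intpart_mono x (leq_addr d k); lia.
Qed.

Lemma psum_lower x k : k * nth 0 x k.-1 <= psum x k.
Proof.
elim: k => [//|k IH]; rewrite psumS mulSn addnC leq_add2r.
by apply: leq_trans IH; rewrite leq_mul2l intpart_mono ?orbT ?leq_pred.
Qed.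

Lemma psum_upper x k : psum x k <= k * nth 0 x 0.
Proof.
elim: k => [|k IH]; first by rewrite /psum big_ord0.
by rewrite psumS mulSn addnC leq_add ?intpart_mono.
Qed.

(** Termwise comparison on rows j to k - 1, with terms moved across to avoid truncated
    subtraction. *)
Lemma psum_leD (s t : seq nat) j k : j <= k ->
  (forall i, j <= i < k -> nth 0 s i <= nth 0 t i) ->
  psum s k + psum t j <= psum t k + psum s j.
Proof.
elim: k => [|k IH]; first by rewrite leqn0 => /eqP -> _; rewrite addnC.
rewrite leq_eqVlt => /orP[/eqP -> _|]; first by rewrite addnC.
rewrite ltnS => jk st; rewrite !psumS.
have {}IH : psum s k + psum t j <= psum t k + psum s j.
  by apply: IH => // i /andP[ji ik]; rewrite st // ji ltnW.
by have := st k; rewrite jk ltnSn => /(_ isT); lia.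
Qed.

(* The first k parts of x take at most two consecutive values and the others are
   at most 1, so in each range the part of y at row j decides on which side of j
   the parts of x and y can be compared termwise. *)
Lemma intpart_le_crit x y k :
  nth 0 x 0 <= (nth 0 x k.-1).+1 -> nth 0 x k <= 1 ->
  psum x k <= psum y k -> (x <= y)%O.
Proof.
move=> x0 xk xyk; rewrite intpart_leE; apply/dominatedP => j.
have psum0 (s : seq nat) : psum s 0 = 0 by rewrite /psum big_ord0.
case: (leqP j k) => jk.
  case: (leqP (nth 0 y j) (nth 0 x k.-1)) => yj.
    suff: psum y k + psum x j <= psum x k + psum y j by lia.
    apply: psum_leD => // i /andP[ji ik].
    have := intpart_mono y ji; have := @intpart_mono x i k.-1; lia.
  suff: psum x j + psum y 0 <= psum y j + psum x 0 by rewrite !psum0; lia.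
  apply: psum_leD => // i /andP[_ ij].
  have := intpart_mono x (leq0n i); have := @intpart_mono y i j; lia.
case: (posnP (nth 0 y j)) => yj; first by rewrite (psum_nth0 yj) psum_le.
suff: psum x j + psum y k <= psum y j + psum x k by lia.
apply: psum_leD => [|i /andP[ki ij]]; first exact: ltnW.
have := intpart_mono x ki; have := @intpart_mono y i j; lia.
Qed.

(** * Partitions from concave partial sums, and box moves *)

Lemma intpart_of_psum (F : nat -> nat) : F 0 = 0 ->
  (forall k, n <= k -> F k = n) -> (forall k, F k <= F k.+1) ->
  (forall k, F k + F k.+2 <= (F k.+1).*2) ->
  exists x, forall k, psum x k = F k.
Proof.
move=> F0 Fn Fmono Fconc; pose t := [tuple F i.+1 - F i | i < n].
have tE i : nth 0 t i = F i.+1 - F i.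
  case: (ltnP i n) => ni; first by rewrite -(tnth_nth 0 _ (Ordinal ni)) tnth_mktuple.
  by rewrite nth_default ?size_tuple // !Fn ?subnn // leqW.
have psumE k : psum t k = F k.
  elim: k => [|k IH]; first by rewrite F0 /psum big_ord0.
  by rewrite psumS IH tE subnKC.
have tP : is_intpart t.
  apply/andP; split; last by rewrite -(@psum_size _ n) ?size_tuple // psumE Fn.
  apply/(sortedP 0) => i _; rewrite !tE.
  by have := Fconc i; have := Fmono i; have := Fmono i.+1; rewrite /geq /=; lia.
by exists (IntPart tP).
Qed.

(** Lowering the sums endangers concavity only at s + 1 and t. The descents after row s and before
    row t save it, and the gap of 2 does when s + 1 = t. *)
Lemma move_box x s t : s < t -> nth 0 x s.+1 < nth 0 x s ->
  nth 0 x t < nth 0 x t.-1 -> (nth 0 x t).+1 < nth 0 x s ->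
  exists z, forall k, psum z k = psum x k - (s < k <= t).
Proof.
move=> st xs xt xts.
(* The lowered sums must still be n from index n on. Rows before t are nonempty and row s has at
   least two boxes, so [psum x t] is at least t + 1. *)
have tn : t < n.
  have low : forall k, k <= t -> k + (s < k) <= psum x k.
    elim=> [//|k IH] kt; rewrite psumS.
    have := IH (ltnW kt); have := @intpart_mono x k t.-1.
    case: (ltngtP k s) => [ks|ks|->]; lia.
  by have := low t (leqnn t); have := psum_le x t; rewrite st; lia.
apply: intpart_of_psum => [|k nk|k|k].
- by rewrite /psum big_ord0.
- by rewrite psum_full //; lia.
- rewrite psumS.
  by case: (k =P s) => [->|]; lia.
- rewrite !psumS; have := intpart_noninc x k.
  have x1 : 0 < k <= t -> 1 <= psum x k.
    case: k => // k /andP[_ kt]; rewrite psumS.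
    have := @intpart_mono x k t.-1; lia.
  have x0 : nth 0 x s <= psum x s.+1 by rewrite psumS leq_addl.
  have psm : s < k -> psum x s.+1 <= psum x k by exact: leq_psum.
  case: (k.+1 =P s) => [E|]; first by move: xs xts; rewrite -E; lia.
  case: (k =P s) => [E|].
    by move: xs xts; rewrite -E; case: (k.+1 =P t) => [<-|]; lia.
  case: (k.+1 =P t) => [E|]; first by move: xt xts; rewrite -E /=; lia.
  lia.
Qed.

(** The box goes from the last row as long as row a to the first row as short as row b, so the range
    of the move lies within that of a and b. *)
Lemma move_box_lt x a b : (nth 0 x b).+1 < nth 0 x a ->
  exists2 z, (z < x)%O & forall k, psum x k <= psum z k + (a < k <= b).
Proof.
move=> xab.
have exs : exists k, nth 0 x k < nth 0 x a by exists b; lia.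
case: (ex_minnP exs) => s xs smin.
have ext : exists k, nth 0 x k <= nth 0 x b by exists b.
case: (ex_minnP ext) => t xt tmin.
have lt_as : a < s by rewrite ltnNge; apply/negP => /(intpart_mono x); lia.
have lt_at : a < t by rewrite ltnNge; apply/negP => /(intpart_mono x); lia.
have le_tb : t <= b by apply: tmin.
have xt1 : nth 0 x b < nth 0 x t.-1 by rewrite ltnNge; apply/negP => /tmin; lia.
have xs1 : nth 0 x a <= nth 0 x s.-1 by rewrite leqNgt; apply/negP => /smin; lia.
have xtb := intpart_mono x le_tb.
have lt_st : s.-1 < t by rewrite ltnNge; apply/negP => /(intpart_mono x); lia.
have [||||z zE] := @move_box x s.-1 t; rewrite ?prednK; try lia.
exists z; last by move=> k; rewrite zE; lia.
rewrite lt_neqAle; apply/andP; split.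
  apply/eqP => /(congr1 (fun u => psum (parts u) t)); rewrite zE.
  have := psumS x t.-1; rewrite prednK; lia.
by rewrite intpart_leE; apply/dominatedP => k; rewrite zE leq_subr.
Qed.

(** * Characterization of the join-irreducible partitions *)

Definition big_rows x := find (fun v => v <= 1) x.

Lemma ltn_big_rows x i : (i < big_rows x) = (1 < nth 0 x i).
Proof.
apply/idP/idP => [/(before_find 0) /negbT|]; first by rewrite -ltnNge.
rewrite !ltnNge; apply: contra => ri; apply: leq_trans (intpart_mono x ri) _.
case: (boolP (has (fun v => v <= 1) x)) => [/(nth_find 0) //|nh].
by rewrite nth_default // leqNgt -has_find.
Qed.

(* Rows are numbered from 0: the smallest part >= 2 is [nth 0 x l.-1]. *)
Definition near_rect x (l : nat) : bool :=
  [&& 0 < l, 1 < nth 0 x l.-1, nth 0 x l <= 1,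
      nth 0 x 0 <= (nth 0 x l.-1).+1 &
      (nth 0 x l == 1) && (nth 0 x l.-1 == 2) ==> (nth 0 x 0 == 2)].

Lemma near_rect_big_rows x l : near_rect x l -> big_rows x = l.
Proof.
case/and5P=> l0 xl1 xl _ _.
by have := ltn_big_rows x l; have := ltn_big_rows x l.-1; lia.
Qed.

Lemma join_irreducible_near_rect x : join_irreducible x = near_rect x (big_rows x).
Proof.
apply/join_irreducibleP/idP => [[y yx ymax]|].
  have xy : ~~ (x <= y)%O by rewrite (lt_geF yx).
  have yxk k : psum y k <= psum x k.
    by move: k; apply/dominatedP; rewrite -intpart_leE ltW.
  (* The result of a move is below y, so x and y have equal partial sums outside the range of the
     move. *)
  have move_le a b : (nth 0 x b).+1 < nth 0 x a ->
      forall k, psum x k <= psum y k + (a < k <= b).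
    case/move_box_lt => z /ymax; rewrite intpart_leE => /dominatedP zy zE k.
    by apply: leq_trans (zE k) _; rewrite leq_add2r.
  set l := big_rows x; have xl : nth 0 x l <= 1 by rewrite leqNgt -ltn_big_rows ltnn.
  have l0 : 0 < l.
    rewrite lt0n; apply: contra xy => /eqP l0; rewrite l0 in xl.
    by apply: (@intpart_le_crit _ _ 0) => //; rewrite /psum !big_ord0.
  have xl1 : 1 < nth 0 x l.-1 by rewrite -ltn_big_rows prednK.
  (* Row n is empty, so row l - 1 can always lose a box downwards. *)
  have Hright := @move_le l.-1 n; rewrite (intpart_nth0 x (leqnn n)) in Hright.
  have {}Hright := Hright xl1.
  rewrite /near_rect l0 xl1 xl /=; apply/andP; split.
    (* A gap of 2 among the first l rows gives a move with range disjoint from that of [Hright]. *)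
    rewrite leqNgt; apply: contra xy => /move_le Hleft.
    rewrite intpart_leE; apply/dominatedP => k.
    have := Hleft k; have := Hright k; lia.
  apply/implyP => /andP[/eqP xl_1 /eqP xl_2]; apply: contraT => x02.
  have x03 : (nth 0 x l).+1 < nth 0 x 0.
    have := intpart_mono x (leq0n l.-1); lia.
  have Hleft := move_le _ _ x03; case/negP: xy.
  rewrite intpart_leE; apply/dominatedP => k.
  have := Hleft k; have := Hright k; case: (k =P l) => [->|]; last lia.
  move=> _ _.
  (* Only index l is left. Rows l - 1 and l of y hold 3 boxes in total, as in x, so the first holds
     at least 2. *)
  have := Hleft l.+1; have := Hright l.-1; have := yxk l.-1; have := yxk l.+1.
  have := intpart_noninc y l.-1.
  have := psumS y l.-1; have := psumS y l; have := psumS x l.-1; have := psumS x l.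
  rewrite prednK //; lia.
set l := big_rows x => /and5P[l0 xl1 xl x0 two].
have [t [lt_lt xt xtl xk]] : exists t, [/\ l <= t, nth 0 x t < nth 0 x t.-1,
    (nth 0 x t).+1 < nth 0 x l.-1 &
    forall k, l <= k <= t -> nth 0 x 0 <= (nth 0 x k.-1).+1].
  case: (ltnP (nth 0 x l).+1 (nth 0 x l.-1)) => gap.
    exists l; split=> // [|k kl]; first exact: ltnW.
    by have -> : k = l by lia.
  (* Here row l is 1 and row l - 1 is 2, so row 0 is 2 as well, and the comparison criterion applies
     up to the first empty row. *)
  have ext : exists k, nth 0 x k == 0 by exists n; rewrite intpart_nth0.
  case: (ex_minnP ext) => t /eqP xt tmin.
  have xpos k : k < t -> 0 < nth 0 x k.
    by move=> kt; rewrite lt0n; apply/negP => /tmin; lia.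
  exists t; rewrite xt; split=> //.
  - by rewrite leqNgt; apply/negP => /ltnW /(intpart_mono x); lia.
  - by apply: xpos; case: (t) xt => [xt|//]; have := intpart_mono x (leq0n l); lia.
  - move=> k /andP[lk kt]; have := xpos k.-1; lia.
have [||||y yE] := @move_box x l.-1 t; rewrite ?prednK; try lia.
have xpos k : l <= k -> 0 < psum x k.
  by move=> lk; apply: leq_trans (leq_psum x lk); rewrite -(prednK l0) psumS; lia.
exists y => [|z zx].
  rewrite lt_neqAle; apply/andP; split.
    apply/eqP => /(congr1 (fun u => psum (parts u) l)); rewrite yE.
    by have := xpos l; lia.
  by rewrite intpart_leE; apply/dominatedP => k; rewrite yE leq_subr.
rewrite intpart_leE; apply/dominatedP => k; rewrite yE.
have zxk : psum z k <= psum x k.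
  by move: k; apply/dominatedP; rewrite -intpart_leE ltW.
case: (boolP (l.-1 < k <= t)) => [kI|_]; last by rewrite subn0.
suff: psum z k < psum x k by lia.
rewrite ltnNge; apply: contraFN (lt_geF zx) => xzk.
apply: intpart_le_crit xzk; first by apply: xk; lia.
by apply: leq_trans xl; apply: intpart_mono; lia.
Qed.

(** * Encoding by pairs (m, l) *)

Definition rect_code x : 'I_n.+1 * 'I_n.+1 :=
  (inord (psum x (big_rows x)), inord (big_rows x)).

(** The case m = n is that of no part 1. *)
Definition code_ok (p : 'I_n.+1 * 'I_n.+1) : bool :=
  (0 < p.2) && (if p.1 == n :> nat then 2 * p.2 <= n
                else (3 * p.2 <= p.1) || (2 * p.2 == p.1)).

Lemma big_rows_le x : big_rows x <= n.
Proof. by rewrite (leq_trans (find_size _ _)) // size_tuple. Qed.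

(** Equal codes make the comparison criterion at k = l apply in both directions. *)
Lemma rect_code_inj x y : near_rect x (big_rows x) -> near_rect y (big_rows y) ->
  rect_code x = rect_code y -> x = y.
Proof.
have half u v : near_rect u (big_rows u) -> rect_code u = rect_code v -> (u <= v)%O.
  case/and5P=> _ _ ul u0 _ [/(congr1 val) /= + /(congr1 val) /=].
  rewrite !inordK ?ltnS ?psum_le ?big_rows_le // => E1 E2.
  by apply: intpart_le_crit u0 ul _; rewrite E1 E2.
by move=> Hx Hy E; apply/eqP; rewrite eq_le !half.
Qed.

Lemma rect_code_ok x : near_rect x (big_rows x) -> code_ok (rect_code x).
Proof.
case/and5P=> l0 xl1 xl x0 two.
rewrite /code_ok /= !inordK ?ltnS ?psum_le ?big_rows_le // l0 /=.
have low := psum_lower x (big_rows x); have up := psum_upper x (big_rows x).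
set l := big_rows x in l0 xl1 xl x0 two low up *.
have low2 : l * 2 <= psum x l by apply: leq_trans low; rewrite leq_mul2l xl1 orbT.
case: eqP => [E|nE]; first by rewrite mulnC (leq_trans low2) ?E.
have xl_1 : nth 0 x l = 1.
  by have := @psum_nth0 x l; case: (nth 0 x l) xl => [|[|]] // _ /(_ erefl).
move: two; rewrite xl_1 eqxx /=; case: eqP => [_ /eqP x2|/eqP xl2 _].
  by rewrite x2 in up; apply/orP; right; lia.
apply/orP; left; rewrite mulnC; apply: leq_trans low; rewrite leq_mul2l; lia.
Qed.

Lemma code_ok_rect p : code_ok p ->
  exists2 x, near_rect x (big_rows x) & rect_code x = p.
Proof.
case: p => [[m mn] [l ln]]; rewrite /code_ok /= => /andP[l0 ok].
have lm : 2 * l <= m by move: ok; case: eqP => [->|_] //; lia.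
pose q := m %/ l; pose r := m %% l.
have mE : m = l * q + r by rewrite mulnC -divn_eq.
have rl : r < l by rewrite ltn_mod.
have q2 : 2 <= q by rewrite leq_divRL.
clearbody q r.
(* Partial sums of r parts q + 1, then l - r parts q, then n - m parts 1. *)
have [||||x xE] := @intpart_of_psum (fun k =>
  if k <= l then k * q + minn k r else minn n (m + (k - l))).
- by rewrite min0n.
- by move=> k nk; case: leqP; lia.
- by move=> k; case: (ltngtP k l) => kl; rewrite ?mulSn; lia.
- move=> k; case: (ltngtP k.+1 l) => [kl|lk|kl].
  + by rewrite !ifT ?mulSn; lia.
  + by case: (leqP k l) => h; [have -> : k = l by lia|]; lia.
  + by move: mE; rewrite -kl leqnSn mulSn; lia.
have part k := psumS x k.
have nr : near_rect x l.
  have x0 := part 0; have xl1 := part l.-1; have xl := part l.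
  move: x0 xl1 xl; rewrite (prednK l0) !xE (leq_pred l) leqnn l0 ltnn subSnn.
  move=> x0 xl1 xl.
  have {}xl1 : nth 0 x l.-1 = q by have := mulSn l.-1 q; rewrite prednK //; lia.
  have {}xl : nth 0 x l = minn n m.+1 - m by lia.
  have {}x0 : nth 0 x 0 = q + minn 1 r by move: x0 => /=; lia.
  rewrite /near_rect xl xl1 x0 l0 q2 /=; apply/and3P; split; [lia|lia|].
  apply/implyP => /andP[nm /eqP q2E].
  (* With q = 2, m = 2l + r < 3l, so the code condition leaves 2l = m and r = 0. *)
  by move: ok; rewrite ifF; nia.
exists x; first by rewrite (near_rect_big_rows nr).
rewrite /rect_code (near_rect_big_rows nr) xE leqnn.
congr (_, _); apply: val_inj; rewrite /= inordK //; lia.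
Qed.

Lemma card_JI_code : #|JI (intpart n)| = #|[set p | code_ok p]|.
Proof.
have <- : rect_code @: JI (intpart n) = [set p | code_ok p].
  apply/setP => p; rewrite inE; apply/imsetP/idP => [[x]|/code_ok_rect[x nx <-]].
    by rewrite inE join_irreducible_near_rect => /rect_code_ok ? ->.
  by exists x; rewrite // inE join_irreducible_near_rect.
rewrite card_in_imset // => x y; rewrite !inE !join_irreducible_near_rect.
exact: rect_code_inj.
Qed.
End Partitions.

(** * Counting the pairs *)

Lemma sum_muln_le d N m : 0 < d -> m <= N ->
  \sum_(l < N.+1) ((0 < l) && (d * l <= m)) = m %/ d.
Proof.
move=> d0 mN; rewrite big_ord_recl /= add0n.
rewrite (eq_bigr (fun i : 'I_N => nat_of_bool (i < m %/ d))); last first.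
  by move=> i _; rewrite leq_divRL // mulnC.
have cN : m %/ d <= N by apply: leq_trans (leq_div _ _) mN.
by rewrite -[RHS]card_ord -sum1_card (big_ord_widen N (fun=> 1) cN) [RHS]big_mkcond.
Qed.

(** There are n / 2 pairs with m = n and (n - 1) / 2 with m = 2l < n, in total n - 1; each m < n has
    m / 3 further pairs, with 3l <= m. *)
Lemma card_code n : 0 < n ->
  #|[set p | @code_ok n p]| = n.-1 + \sum_(m < n) m %/ 3.
Proof.
move=> n0; rewrite -sum1_card big_mkcond /=.
rewrite (eq_bigr (fun p : 'I_n.+1 * 'I_n.+1 =>
  nat_of_bool (code_ok (p.1, p.2)))); last first.
  by case=> a b _; rewrite inE; case: (code_ok _).
rewrite -(pair_big xpredT xpredT (fun a b => nat_of_bool (@code_ok n (a, b)))) /=.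
rewrite big_ord_recr /=.
rewrite [X in _ + X](eq_bigr (fun l : 'I_n.+1 =>
  nat_of_bool ((0 < l) && (2 * l <= n)))); last first.
  by move=> l _; rewrite /code_ok /= eqxx.
rewrite sum_muln_le //.
rewrite (eq_bigr (fun m : 'I_n => \sum_(l < n.+1) ((0 < l) && (3 * l <= m)) +
   \sum_(l < n.+1) ((0 < l) && (2 * l == m)))); last first.
  move=> m _; rewrite -big_split; apply: eq_bigr => l _.
  by rewrite /code_ok /= ifF ?(ltn_eqF (ltn_ord m)) //; lia.
rewrite big_split /= (eq_bigr (fun m : 'I_n => m %/ 3)); last first.
  by move=> m _; rewrite sum_muln_le // ltnW.
(* For fixed l, at most one m satisfies 2l = m. *)
rewrite exchange_big /=.
rewrite [X in _ + X + _](eq_bigr (fun l : 'I_n.+1 =>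
  nat_of_bool ((0 < l) && (2 * l <= n.-1)))).
  by rewrite sum_muln_le; lia.
move=> l _; case: (ltnP (2 * l) n) => ln.
  rewrite (bigD1 (Ordinal ln)) //= eqxx big1 => [|m]; first lia.
  by rewrite -val_eqE /= eq_sym => /negPf ->; rewrite andbF.
rewrite big1 => [|m _]; first lia.
have := ltn_ord m; lia.
Qed.

Theorem theorem4 :
  #|JI (intpart 1)| = 0 /\
  forall n : nat, 1 <= n ->
    #|JI (intpart n.+1)| = #|JI (intpart n)| + n %/ 3 + 1.
Proof.
split=> [|n n0]; first by rewrite card_JI_code card_code // big_ord_recr big_ord0.
by rewrite !card_JI_code !card_code // big_ord_recr /=; lia.
Qed.
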